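(* Let $\alpha\ge 0$ be real. Then for every $f\in L_{w(\alpha)}$, $$\lim_{k\to\infty}\hat f_\alpha(k)=0 .$$
   Context: For real $\alpha>-1$, $L_{w(\alpha)}$ is the space of (complex-valued) measurable functions $f$ on $(0,\infty)$ with $$\|f\|_{L_{w(\alpha)}}=\int_0^\infty |f(x)|\,e^{-x/2}x^\alpha\,dx<\infty .$$ For $k\in\mathbb{N}_0$, $L_k^\alpha(x)$ is the classical Laguerre polynomial of degree $k$ and order $\alpha$, with $L_k^\alpha(0)=\binom{k+\alpha}{k}=\frac{\Gamma(k+\alpha+1)}{\Gamma(k+1)\Gamma(\alpha+1)}$, and the normalized Laguerre polynomials are $R_k^\alpha(x)=L_k^\alpha(x)/L_k^\alpha(0)$. The Fourier--Laguerre coefficients of $f$ are $$\hat f_\alpha(k)=\int_0^\infty f(x)\,R_k^\alpha(x)\,x^\alpha e^{-x}\,dx$$ when the integrals exist. *)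

(* Defs.v *)
From HB Require Import structures.
From mathcomp Require Export all_boot all_order all_algebra.
From mathcomp Require Export all_classical all_reals all_analysis.
From mathcomp Require Export complex.
Export Order.TTheory GRing.Theory Num.Theory.
Export numFieldNormedType.Exports.

Set Implicit Arguments.
Unset Strict Implicit.
Unset Printing Implicit Defensive.

Local Open Scope classical_set_scope.
Local Open Scope ring_scope.

Section ComplexIntegral.
Context d (T : measurableType d) (R : realType) (mu : {measure set T -> \bar R}).
Implicit Types (D : set T) (f : T -> R[i]).

(* Identifying R[i] with R * R, a map is Borel measurable iff both of its
   components are. *)
Definition complex_measurable_fun D f :=
  measurable_fun D (fun x => complex.Re (f x)) /\
  measurable_fun D (fun x => complex.Im (f x)).

Definition complex_integrable D f :=
  mu.-integrable D (EFin \o (fun x => complex.Re (f x))) /\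
  mu.-integrable D (EFin \o (fun x => complex.Im (f x))).

Definition complex_integral D f : R[i] :=
  Complex (\int[mu]_(x in D) complex.Re (f x)) (\int[mu]_(x in D) complex.Im (f x)).

End ComplexIntegral.

Section Laguerre.
Context {R : realType}.
Implicit Types (alpha x : R) (k : nat).

(* x (x - 1) ... (x - k + 1) / k!; for x = k + alpha with alpha > -1 this is
   Gamma(k + alpha + 1) / (Gamma(k + 1) Gamma(alpha + 1)). *)
Definition gbinom x k : R := (\prod_(i < k) (x - i%:R)) / k`!%:R.

(* L_k^alpha(x) = \sum_(j <= k) (-1)^j binom(k + alpha, k - j) x^j / j! *)
Definition laguerre alpha k : {poly R} :=
  \poly_(j < k.+1) ((-1) ^+ j * gbinom (k%:R + alpha) (k - j) / j`!%:R).

Definition nlaguerre alpha k x : R :=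
  (laguerre alpha k).[x] / (laguerre alpha k).[0].

Lemma laguerre_at0 alpha k : (laguerre alpha k).[0] = gbinom (k%:R + alpha) k.
Proof. by rewrite horner_coef0 coef_poly /= subn0 expr0 mul1r divr1. Qed.

End Laguerre.

Section LaguerreCoefficients.
Context {R : realType}.

(* The completed measure makes "measurable" mean Lebesgue measurable; the
   library's lebesgue_measure is defined on the Borel sets only. *)
Local Notation mu := (@completed_lebesgue_measure R).

(* R with the Lebesgue measurable sets, i.e. the domain of mu *)
Local Notation T := (caratheodory_type (wlength (@idfun R))^*%mu).

Local Notation D := (`]0, +oo[%classic : set R).

Definition Lw_norm (alpha : R) (f : R -> R[i]) : \bar R :=
  (\int[mu]_(x in D)
     (Normc.normc (f x) * expR (- (x / 2)) * x `^ alpha)%:E)%E.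

Definition in_Lw (alpha : R) (f : R -> R[i]) : Prop :=
  @complex_measurable_fun _ T R D f /\ (Lw_norm alpha f < +oo)%E.

Definition laguerre_integrand (alpha : R) (f : R -> R[i]) (k : nat) (x : R) : R[i] :=
  f x * (nlaguerre alpha k x * x `^ alpha * expR (- x))%:C%C.

Definition laguerre_coef_exists (alpha : R) (f : R -> R[i]) (k : nat) : Prop :=
  complex_integrable mu D (laguerre_integrand alpha f k).

(* Meaningful only when laguerre_coef_exists holds. *)
Definition laguerre_coef (alpha : R) (f : R -> R[i]) (k : nat) : R[i] :=
  complex_integral mu D (laguerre_integrand alpha f k).

End LaguerreCoefficients.

(* Main.v *)
Require Import Defs.
From mathcomp Require Import measurable_realfun ring lra.
Local Open Scope classical_set_scope.
Local Open Scope ring_scope.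

(** The theorem is an instance of dominated convergence.  It rests on two facts
    about the normalized Laguerre polynomials R_k of order alpha >= 0: the bound
    |R_k(x)| <= exp(x/2) for x >= 0 ([nlaguerre_bound]), which makes the
    integrable function |f(x)| exp(-x/2) x^alpha a majorant of all the
    integrands, and the pointwise limit R_k(x) -> 0 for x > 0
    ([nlaguerre_cvg0]).

    Both facts reduce to order zero.  For alpha >= 0, R_n is an average of
    L_0, ..., L_n with nonnegative weights ([laguerre_sum]); this transfers the
    bound, and, as each fixed index carries vanishing weight
    ([negbinom_ratio_cvg0]), it transfers the limit ([weighted_mean_cvg0]).

    For order zero, L_n(x) exp(-x/2) is a diagonal matrix coefficient of a
    unitary operator, the displacement by z = sqrt(x) on Bargmann-Fock space, and
    is therefore at most 1 in absolute value ([laguerre0_bound]).  This is proved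
    on power series coefficients: the squared norm of (w - z)^n exp(z w) is
    n! exp(z^2) ([displaced_sqnorm_cvg]), and one term of it is n! L_n(x)^2.

    For the limit, the recurrence in n with x > 0 fixed is a slowly varying
    harmonic oscillator.  A quadratic energy loses at each step a fraction of
    order 1/n of its value ([energy_bounds]), hence tends to 0 because the
    harmonic series diverges ([cvg0_of_harmonic_decrease]). *)

(** * Generalized binomial coefficients *)

Section GeneralizedBinomials.
Context {R : realType}.
Implicit Types (x a : R) (n k j : nat).

Lemma gbinom0 x : gbinom x 0 = 1.
Proof. by rewrite /gbinom big_ord0 fact0 divr1. Qed.

Lemma gbinomS x k : k.+1%:R * gbinom x k.+1 = (x - k%:R) * gbinom x k.
Proof.
rewrite /gbinom big_ord_recr /= factS natrM.
have k0 : k.+1%:R != 0 :> R by rewrite pnatr_eq0.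
have f0 : k`!%:R != 0 :> R by rewrite pnatr_eq0 -lt0n fact_gt0.
by field; rewrite f0 nat1r k0.
Qed.

Lemma gbinom_absorb x k : k.+1%:R * gbinom (x + 1) k.+1 = (x + 1) * gbinom x k.
Proof.
rewrite /gbinom big_ord_recl /= factS natrM subr0.
rewrite (eq_bigr (fun i : 'I_k => x - i%:R)); last first.
  by move=> i _; rewrite /bump /= add1n -natr1; ring.
have k0 : k.+1%:R != 0 :> R by rewrite pnatr_eq0.
have f0 : k`!%:R != 0 :> R by rewrite pnatr_eq0 -lt0n fact_gt0.
by field; rewrite f0 nat1r k0.
Qed.

Lemma gbinom_pascal x k : gbinom (x + 1) k.+1 = gbinom x k.+1 + gbinom x k.
Proof.
have k0 : k.+1%:R != 0 :> R by rewrite pnatr_eq0.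
apply: (mulfI k0); rewrite gbinom_absorb mulrDr gbinomS -natr1; ring.
Qed.

Lemma gbinom_nat n k : gbinom (n%:R : R) k = 'C(n, k)%:R.
Proof.
elim: n k => [|n IHn] [|k]; rewrite ?gbinom0 ?bin0 //.
  have k0 : k.+1%:R != 0 :> R by rewrite pnatr_eq0.
  rewrite bin0n /=; elim: k k0 => [|k IHk] k0.
    by apply: (mulfI k0); rewrite gbinomS subr0 mulr0 mul0r.
  by apply: (mulfI k0); rewrite gbinomS IHk ?mulr0 // pnatr_eq0.
by rewrite -natr1 gbinom_pascal !IHn binS natrD.
Qed.

(** The coefficient of t^n in (1 - t)^(-a). *)
Definition negbinom a n : R := gbinom (a - 1 + n%:R) n.

Lemma negbinom_ge0 a n : 0 <= a -> 0 <= negbinom a n.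
Proof.
move=> a0; apply: divr_ge0 => //; apply: prodr_ge0 => i _.
have : i.+1%:R <= n%:R :> R by rewrite ler_nat.
by rewrite -natr1; lra.
Qed.

(** The binomial on the right is the sum of the [negbinom a i] for i <= n (the
    case j = 0 of the next lemma), of which the last term is therefore only the
    fraction a/(a + n). *)
Lemma negbinom_mul a n :
  (a + n%:R) * negbinom a n = a * gbinom (n%:R + a) n.
Proof.
case: n => [|n]; first by rewrite /negbinom !gbinom0 addr0.
have k0 : n.+1%:R != 0 :> R by rewrite pnatr_eq0.
apply: (mulfI k0); rewrite mulrCA gbinomS.
have -> : n.+1%:R + a = (a - 1 + n.+1%:R) + 1 by ring.
by rewrite [RHS]mulrCA gbinom_absorb -natr1; ring.
Qed.

(** Coefficient comparison in (1 - t)^(-a) (1 - t)^(-j-1) = (1 - t)^(-a-j-1).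
    Both sides satisfy Pascal's rule in (n, j), so a double induction replaces
    the power series. *)
Lemma sum_negbinom_bin a n j : (j <= n)%N ->
  \sum_(i < n.+1) negbinom a i * 'C(n - i, j)%:R = gbinom (n%:R + a) (n - j).
Proof.
elim: j n => [|j IHj] n.
  move=> _; rewrite subn0; elim: n => [|n IHn].
    by rewrite big_ord_recl big_ord0 /negbinom !gbinom0 bin0 mulr1 addr0.
  rewrite big_ord_recr /= bin0 mulr1.
  under eq_bigr => i _ do rewrite bin0 -(bin0 (n - i)).
  have -> : n.+1%:R + a = (n%:R + a) + 1 by rewrite -natr1; ring.
  rewrite gbinom_pascal IHn addrC /negbinom.
  by congr (gbinom _ _ + _); rewrite -natr1; ring.
have step m : \sum_(i < m.+2) negbinom a i * 'C(m.+1 - i, j.+1)%:R =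
    \sum_(i < m.+1) negbinom a i * 'C(m - i, j.+1)%:R +
    \sum_(i < m.+1) negbinom a i * 'C(m - i, j)%:R.
  rewrite big_ord_recr /= subnn bin0n mulr0 addr0 -big_split /=.
  apply: eq_bigr => i _; rewrite -mulrDr -natrD subSn ?binS //.
  by rewrite -ltnS.
elim: n => [//|n IHn]; rewrite ltnS => jn.
rewrite step (IHj n) // subSS.
move: jn; rewrite leq_eqVlt => /orP [/eqP <-|jn].
  rewrite big1 ?add0r ?subnn ?gbinom0 // => i _.
  by rewrite bin_small ?mulr0 // ltnS leq_subr.
rewrite IHn // subnS; case: (n - j)%N (subn_gt0 j n) => [|m] /=; first by rewrite jn.
move=> _; have -> : n.+1%:R + a = (n%:R + a) + 1 by rewrite -natr1; ring.
by rewrite gbinom_pascal addrC.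
Qed.

End GeneralizedBinomials.

(** * Reduction to order zero, and the recurrence in the degree *)

Section LaguerrePolynomials.
Context {R : realType}.
Implicit Types (x a : R) (n k j : nat).

Local Notation L k x := ((laguerre 0 k).[x]).

Definition laguerre_monomial x j : R := (-1) ^+ j / j`!%:R * x ^+ j.

(** Any N above the degree may bound the sum, which lets polynomials of
    different degrees be subtracted term by term. *)
Lemma laguerre0E n N x : (n < N)%N ->
  L n x = \sum_(j < N) laguerre_monomial x j * 'C(n, j)%:R.
Proof.
move=> nN; rewrite horner_poly.
rewrite (big_ord_widen N (fun j => (-1) ^+ j * gbinom (n%:R + 0) (n - j) / j`!%:R
   * x ^+ j)) // big_mkcond; apply: eq_bigr => j _; case: ifPn => [jn|].
  by rewrite addr0 gbinom_nat bin_sub // /laguerre_monomial; ring.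
by rewrite -leqNgt => jn; rewrite bin_small // mulr0.
Qed.

Lemma laguerre_at0_sum a n :
  (laguerre a n).[0] = \sum_(i < n.+1) negbinom a i.
Proof.
rewrite laguerre_at0 -{2}(subn0 n) -(@sum_negbinom_bin _ a) //.
by apply: eq_bigr => i _; rewrite bin0 mulr1.
Qed.

(** The generating function of L_n^a is (1 - t)^(-a) times that of L_n^0.  For
    a >= 0 the coefficients are nonnegative, and they add up to L_n^a(0)
    ([laguerre_at0_sum]): the normalized polynomial of order a is an average of
    the polynomials of order zero. *)
Lemma laguerre_sum a n x :
  (laguerre a n).[x] = \sum_(k < n.+1) negbinom a (n - k) * L k x.
Proof.
rewrite (reindex_inj rev_ord_inj) /=.
under eq_bigr => i _.
  rewrite subSS subKn; last by rewrite -ltnS.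
  rewrite (@laguerre0E _ n.+1) ?ltnS ?leq_subr // mulr_sumr.
  over.
rewrite exchange_big horner_poly /=; apply: eq_bigr => j _.
under eq_bigr => i _ do rewrite mulrCA.
rewrite -mulr_sumr sum_negbinom_bin; first by rewrite /laguerre_monomial; ring.
by rewrite -ltnS.
Qed.

Lemma sum_laguerre0 n N x : (n <= N)%N ->
  \sum_(k < n) L k x = \sum_(j < N) laguerre_monomial x j * 'C(n, j.+1)%:R.
Proof.
elim: n => [_|n IHn nN].
  by rewrite big_ord0 big1 // => j _; rewrite bin0n mulr0.
rewrite big_ord_recr /= IHn; last exact: ltnW.
rewrite (@laguerre0E n N) // -big_split /=; apply: eq_bigr => j _.
by rewrite -mulrDr -natrD binS.
Qed.

(** The three-term recurrence in first-order form, with the partial sums of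
    the L_k as second unknown. *)
Lemma laguerre0_rec n x :
  n.+1%:R * (L n.+1 x - L n x) = - (x * \sum_(k < n.+1) L k x).
Proof.
rewrite (@sum_laguerre0 n.+1 n.+1) // (@laguerre0E n.+1 n.+2) //.
rewrite (@laguerre0E n n.+2) // -sumrB big_ord_recl /= !bin0 subrr add0r.
rewrite !mulr_sumr -sumrN; apply: eq_bigr => j _.
rewrite /bump /= add1n binS natrD /laguerre_monomial.
have := mul_bin_diag n.+1 j => /(congr1 (fun m => m%:R : R)).
rewrite factS binS !natrM (natrD _ _ (binomial n j)) !exprS => E.
have j0 : j.+1%:R != 0 :> R by rewrite pnatr_eq0.
have f0 : j`!%:R != 0 :> R by rewrite pnatr_eq0 -lt0n fact_gt0.
rewrite -mulrBr [X in _ * (X - _)]addrC addrK mulrCA E.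
by field; rewrite f0 nat1r j0.
Qed.

End LaguerrePolynomials.

(** * The bound |L_n(x)| <= exp(x/2) *)

Section UniformBound.
Context {R : realType}.
Implicit Types (x z : R) (n m : nat).

Local Notation L k x := ((laguerre 0 k).[x]).

(** The coefficient of w^m in (w - z)^n exp(z w), the image of the monomial w^n
    under the unnormalized displacement operator of the Bargmann-Fock space, in
    which w^m has squared norm m!. *)
Fixpoint displaced z n m : R :=
  match n, m with
  | 0, _ => z ^+ m / m`!%:R
  | n'.+1, 0 => - z * displaced z n' 0
  | n'.+1, m'.+1 => displaced z n' m' - z * displaced z n' m'.+1
  end.

Arguments displaced : simpl never.

Lemma displaced0E z m : displaced z 0 m = z ^+ m / m`!%:R.
Proof. by case: m. Qed.

Lemma displacedS0 z n : displaced z n.+1 0 = - z * displaced z n 0.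
Proof. by []. Qed.

Lemma displacedSS z n m :
  displaced z n.+1 m.+1 = displaced z n m - z * displaced z n m.+1.
Proof. by []. Qed.

Lemma displaced0_rec z m : m.+1%:R * displaced z 0 m.+1 = z * displaced z 0 m.
Proof.
rewrite !displaced0E factS natrM exprS.
have k0 : m.+1%:R != 0 :> R by rewrite pnatr_eq0.
have f0 : m`!%:R != 0 :> R by rewrite pnatr_eq0 -lt0n fact_gt0.
by field; rewrite f0 nat1r k0.
Qed.

(** The product rule for d/dw, the adjoint of multiplication by w, applied to
    (w - z)^(n+1) exp(z w). *)
Lemma displaced_rec z n m :
  m.+1%:R * displaced z n.+1 m.+1 =
  z * displaced z n.+1 m + n.+1%:R * displaced z n m.
Proof.
elim: n m => [|n IHn] m.
  rewrite displacedSS mulrBr [X in _ - X]mulrCA displaced0_rec.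
  case: m => [|m]; first by rewrite displacedS0; ring.
  by rewrite displacedSS -[m.+2%:R]natr1 mulrDl displaced0_rec; ring.
rewrite displacedSS mulrBr [X in _ - X]mulrCA IHn.
case: m => [|m].
  by rewrite !displacedS0 -[n.+2%:R]natr1; ring.
rewrite (displacedSS _ n.+1 m) (displacedSS _ n m) -[m.+2%:R]natr1 mulrDl IHn.
by rewrite -[n.+2%:R]natr1; ring.
Qed.

(** On the diagonal, the two recurrences of the coefficients become
    [laguerre0_rec] at x = z^2, the superdiagonal playing the part of the
    partial sums. *)
Lemma displaced_diag z n :
  displaced z n n = L n (z ^+ 2) /\
  n.+1%:R * (z * displaced z n n.+1) = z ^+ 2 * \sum_(k < n.+1) L k (z ^+ 2).
Proof.
have L0 : L 0 (z ^+ 2) = 1.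
  by rewrite (@laguerre0E _ 0 1) // big_ord1 bin0 /laguerre_monomial !expr0 fact0; field.
elim: n => [|n [IH1 IH2]].
  split; first by rewrite L0 displaced0E fact0 divr1.
  by rewrite mulrCA displaced0_rec big_ord1 L0 displaced0E fact0 divr1; ring.
have E1 : displaced z n.+1 n.+1 = L n.+1 (z ^+ 2).
  have k0 : n.+1%:R != 0 :> R by rewrite pnatr_eq0.
  have := laguerre0_rec n (z ^+ 2); rewrite -IH2 -mulrN => /(mulfI k0) E.
  by rewrite displacedSS IH1 -E; ring.
split => //; rewrite mulrCA displaced_rec E1 big_ord_recr /= [RHS]mulrDr -IH2; ring.
Qed.

(** The functions (w - z)^n exp(z w) are entire of exponential type; their
    coefficients are small enough for the boundary terms below to vanish. *)
Lemma displaced_bound z n :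
  exists A r : R, forall m, `|displaced z n m| <= A * (r ^+ m / m`!%:R).
Proof.
elim: n => [|n [A [r IHn]]].
  by exists 1, `|z| => m; rewrite mul1r displaced0E normrM normrX normfV normr_nat.
(* The shift in the recurrence costs a factor m, absorbed by m <= 2^m. *)
exists (`|A| * (1 + `|z|)), (2 * (`|r| + 1)) => m.
have H k : `|displaced z n k| <= `|A| * (`|r| ^+ k / k`!%:R).
  apply: le_trans (IHn k) _; apply: le_trans (ler_norm _) _.
  by rewrite !normrM normfV normr_nat normrX.
have rr k : `|r| ^+ k <= (2 * (`|r| + 1)) ^+ k.
  by apply: lerXn2r; rewrite ?nnegrE; have := normr_ge0 r; lra.
have Q k : `|r| ^+ k / k`!%:R <= (2 * (`|r| + 1)) ^+ k / k`!%:R.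
  by rewrite ler_wpM2r ?invr_ge0.
have Z k : `|z * displaced z n k| <= `|A| * (`|z| * ((2 * (`|r| + 1)) ^+ k / k`!%:R)).
  rewrite normrM mulrCA ler_wpM2l //; apply: le_trans (H k) _.
  by rewrite ler_wpM2l.
case: m => [|m].
  rewrite displacedS0 mulNr normrN; apply: le_trans (Z 0%N) _.
  rewrite expr0 fact0 divr1 !mulr1 ler_wpM2l //; lra.
rewrite displacedSS; apply: le_trans (ler_normB _ _) _.
rewrite -mulrA mulrDl mulrDr mul1r lerD //.
apply: le_trans (H m) _; rewrite ler_wpM2l //.
rewrite exprMn exprS factS natrM invfM.
have r1 : `|r| ^+ m <= (`|r| + 1) ^+ m.
  by apply: lerXn2r; rewrite ?nnegrE; have := normr_ge0 r; lra.
have -> : 2 * 2 ^+ m * (`|r| + 1) ^+ m.+1 * (m.+1%:R^-1 * m`!%:R^-1) =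
   (2 ^+ m.+1 / m.+1%:R * (`|r| + 1) ^+ m.+1) / m`!%:R.
  by move: (m.+1%:R^-1) (m`!%:R^-1) => u v; rewrite [2 ^+ m.+1]exprS; ring.
rewrite ler_wpM2r ?invr_ge0 //.
apply: le_trans r1 _; rewrite [X in _ * X]exprS mulrA.
rewrite ler_peMl ?exprn_ge0 ?addr_ge0 //.
rewrite -[leLHS]mulr1; apply: ler_pM; rewrite ?lerDr //.
by rewrite ler_pdivlMr // mul1r -natrX ler_nat ltnW // ltn_expl.
Qed.

Lemma displaced_boundary_cvg0 z n :
  m`!%:R * (z * (displaced z n m * displaced z n.+1 m)) @[m --> \oo] --> (0 : R).
Proof.
have [A [r HA]] := displaced_bound z n.
have [B [s HB]] := displaced_bound z n.+1.
have := is_cvg_series_exp_coeff (`|r| * `|s|) => /cvg_series_cvg_0 E.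
have {}E : `|z| * `|A| * `|B| * exp_coeff (`|r| * `|s|) m @[m --> \oo] --> (0 : R).
  by rewrite -[0](mulr0 (`|z| * `|A| * `|B|)); apply: cvgMr.
apply/norm_cvg0P; apply: (squeeze_cvgr _ (cvg_cst 0) E).
apply: nearW => m; rewrite normr_ge0 /= /exp_coeff /=.
have f0 : (0 < m`!%:R :> R) by rewrite ltr0n fact_gt0.
have bd (C t u : R) : u <= C * (t ^+ m / m`!%:R) -> u <= `|C| * (`|t| ^+ m / m`!%:R).
  move=> h; apply: le_trans h _; apply: le_trans (ler_norm _) _.
  by rewrite !normrM normfV normr_nat normrX.
rewrite !normrM normr_nat.
have := ler_pM (normr_ge0 _) (normr_ge0 _) (bd _ _ _ (HA m)) (bd _ _ _ (HB m)).
move=> /(ler_wpM2l (normr_ge0 z)) /(ler_wpM2l (ltW f0)) h.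
apply: le_trans h _; rewrite exprMn le_eqVlt; apply/orP; left; apply/eqP.
by field; rewrite gt_eqF.
Qed.

(** The square of the norm, truncated below degree N. *)
Definition displaced_sqnorm z n N : R :=
  \sum_(m < N) m`!%:R * displaced z n m ^+ 2.

(** Summation by parts: with g_n = (w - z)^n exp(z w), the adjunction gives
    |g_(n+1)|^2 = <(w - z) g_n, g_(n+1)> = <g_n, (d/dw - z) g_(n+1)>
    = (n+1) |g_n|^2.  Truncating the norms leaves one boundary term. *)
Lemma displaced_sqnormS z n N :
  displaced_sqnorm z n.+1 N.+1 = n.+1%:R * displaced_sqnorm z n N
   - N`!%:R * (z * (displaced z n N * displaced z n.+1 N)).
Proof.
rewrite /displaced_sqnorm; elim: N => [|N IHN].
  by rewrite big_ord1 big_ord0 displacedS0 fact0; ring.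
rewrite big_ord_recr /= {}IHN [in RHS]big_ord_recr /=.
have := displaced_rec z n N => E.
have -> : displaced z n.+1 N.+1 ^+ 2 =
  displaced z n N * displaced z n.+1 N.+1 - z * displaced z n N.+1 * displaced z n.+1 N.+1.
  by rewrite displacedSS; ring.
rewrite factS natrM.
have E2 : N.+1%:R * N`!%:R * (displaced z n N * displaced z n.+1 N.+1) =
  N`!%:R * displaced z n N * (z * displaced z n.+1 N + n.+1%:R * displaced z n N).
  by rewrite -E; ring.
rewrite mulrBr E2; ring.
Qed.

(** Unitarity of the displacement operator: it maps the orthogonal basis w^n to
    vectors of squared norm n! exp(z^2). *)
Lemma displaced_sqnorm_cvg z n :
  displaced_sqnorm z n N @[N --> \oo] --> n`!%:R * expR (z ^+ 2).
Proof.
elim: n => [|n IHn].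
  rewrite fact0 mul1r.
  have := is_cvg_series_exp_coeff (z ^+ 2); rewrite -/(expR _).
  apply: cvg_trans; apply: near_eq_cvg; apply: nearW => N.
  rewrite /series /= big_mkord; apply: eq_bigr => m _.
  have f0 : m`!%:R != 0 :> R by rewrite pnatr_eq0 -lt0n fact_gt0.
  by rewrite displaced0E /exp_coeff /= exprAC; field.
rewrite -cvg_shiftS /=.
under eq_fun do rewrite displaced_sqnormS.
rewrite factS natrM -mulrA -[n.+1%:R * (_ * expR _)]subr0.
by apply: cvgB (displaced_boundary_cvg0 z n); apply: cvgMr.
Qed.

(** The diagonal coefficient is L_n(x), and its contribution n! L_n(x)^2 cannot
    exceed the whole squared norm n! exp(x). *)
Lemma laguerre0_bound n x : 0 <= x -> `|L n x| <= expR (x / 2).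
Proof.
move=> x0; set z := Num.sqrt x.
have zx : z ^+ 2 = x by rewrite sqr_sqrtr.
have f0 : (0 < n`!%:R :> R) by rewrite ltr0n fact_gt0.
have H : n`!%:R * L n x ^+ 2 <= n`!%:R * expR x.
  rewrite -zx; apply: (cvgr_to_ge (displaced_sqnorm_cvg z n)).
  near=> N; rewrite /displaced_sqnorm.
  have nN : (n < N)%N by near: N; exact: nbhs_infty_gt.
  rewrite (bigD1 (Ordinal nN)) //= (displaced_diag z n).1 lerDl.
  by apply: sumr_ge0 => m _; rewrite mulr_ge0 // sqr_ge0.
rewrite -(@ler_pXn2r _ 2) ?nnegrE ?expR_ge0 //.
rewrite real_normK ?num_real // -expRM_natl.
by move: H; rewrite ler_pM2l // mulr_natl -mulr_natr mulfVK.
Unshelve. all: by end_near. Qed.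

End UniformBound.

(** * Decay of L_n(x) for fixed x > 0 *)

Section Decay.
Context {R : realType}.
Implicit Types (x : R) (n : nat).

Local Notation L k x := ((laguerre 0 k).[x]).

(** The decrements of F are summable, while a positive lower bound on F would
    make them dominate a multiple of the harmonic series. *)
Lemma cvg0_of_harmonic_decrease (F : nat -> R) (c : R) n0 : 0 < c ->
  (forall n, (n0 <= n)%N -> 0 <= F n) ->
  (forall n, (n0 <= n)%N -> c * F n <= n.+1%:R * (F n - F n.+1)) ->
  F n @[n --> \oo] --> 0.
Proof.
move=> c0 F0 Fdec.
have Fmono n : (n0 <= n)%N -> F n.+1 <= F n.
  move=> nn; rewrite -subr_ge0 -(pmulr_rge0 _ (ltr0Sn R n)).
  by apply: le_trans (Fdec n nn); rewrite mulr_ge0 ?F0 // ltW.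
have Fmono2 n m : (n0 <= n)%N -> F (n + m)%N <= F n.
  move=> nn; elim: m => [|m IHm]; first by rewrite addn0.
  by rewrite addnS; apply: le_trans IHm; rewrite Fmono // (leq_trans nn) // leq_addr.
apply/cvgrPdist_lt => e e0.
have [[n [nn ne]]|H] := pselect (exists n, (n0 <= n)%N /\ F n < e).
  near=> m; have nm : (n <= m)%N by near: m; exact: nbhs_infty_ge.
  rewrite sub0r normrN ger0_norm ?F0 ?(leq_trans nn) //.
  by apply: le_lt_trans ne; rewrite -(subnKC nm); exact: Fmono2.
have Fe n : (n0 <= n)%N -> e <= F n.
  by move=> nn; rewrite leNgt; apply/negP => Fn; apply: H; exists n.
exfalso; apply: (@dvg_harmonic R); apply: nondecreasing_is_cvgn.
  by apply: nondecreasing_series => k _ _; exact: harmonic_ge0.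
(* If F >= e, the partial sums of the harmonic series plus F/(c e) decrease. *)
exists (series harmonic n0 + F n0 / (c * e)) => _ [n _ <-].
have ce : 0 < c * e by rewrite mulr_gt0.
have B m : series harmonic (n0 + m)%N + F (n0 + m)%N / (c * e)
    <= series harmonic n0 + F n0 / (c * e).
  elim: m => [|m IHm]; first by rewrite addn0.
  rewrite addnS; apply: le_trans IHm; rewrite seriesSr /= -lerBrDl.
  set n1 := (n0 + m)%N.
  have nn : (n0 <= n1)%N by rewrite leq_addr.
  have h : c * e <= n1.+1%:R * (F n1 - F n1.+1).
    by apply: le_trans (Fdec _ nn); rewrite ler_pM2l // Fe.
  have n10 : 0 < n1.+1%:R :> R by rewrite ltr0Sn.
  have : n1.+1%:R^-1 <= (F n1 - F n1.+1) / (c * e).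
    by rewrite ler_pdivlMr // mulrC ler_pdivrMr // [leRHS]mulrC.
  rewrite mulrBl; move: (F n1 / (c * e)) (F n1.+1 / (c * e)) (series harmonic n1) (n1.+1%:R^-1) => u v s t; lra.
have [nn|/ltnW nn] := leqP n0 n.
  have := B (n - n0)%N; rewrite subnKC //; apply: le_trans.
  by rewrite lerDl divr_ge0 ?F0 // ltW.
apply: le_trans (_ : series harmonic n0 <= _); last first.
  by rewrite lerDl divr_ge0 ?F0 // ltW.
by apply: nondecreasing_series => // k _ _; exact: harmonic_ge0.
Unshelve. all: by end_near. Qed.

(** For N = n, b = L_n and a = x (L_0 + ... + L_(n-1)), the recurrence is a
    symplectic Euler step for the oscillator a' = x b, b' = - a / n, whose exact
    discrete invariant at frozen N is a^2/N + x b^2 + x a b/N.  Growth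
    of N lowers its kinetic part a^2/N; the correction - a b/(2N) averages this
    loss over an oscillation, so that the whole energy decays at rate 1/(2N). *)
Definition energy (N a b x : R) : R :=
  a ^+ 2 / N + x * b ^+ 2 + (x - 2^-1) * (a * b) / N.

Lemma energy_drop (N a b x : R) : 0 < N ->
  (N + 1) * (energy N a b x
     - energy (N + 1) (a + x * b) (b - (a + x * b) / (N + 1)) x) =
  a ^+ 2 / N + (x - 2^-1) * (a * b) / N + x * b ^+ 2 / 2
  - (a + x * b) ^+ 2 / (2 * (N + 1)).
Proof.
move=> N0; rewrite /energy; field.
by rewrite !gt_eqF //; lra.
Qed.

(** For large N the cross terms are a small fraction of a^2/N + x b^2, and the
    drop of the energy, times N + 1, is close to half of that sum. *)
Lemma energy_bounds (N a b x : R) : 0 < x -> 0 < N ->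
    16 * (2 * x + 1) ^+ 2 <= N * x ->
  [/\ 0 <= energy N a b x, x * b ^+ 2 <= 2 * energy N a b x &
  8^-1 * energy N a b x <= (N + 1) * (energy N a b x
     - energy (N + 1) (a + x * b) (b - (a + x * b) / (N + 1)) x)].
Proof.
move=> x0 N0 big; rewrite energy_drop // /energy.
set P := a ^+ 2 / N; set Q := x * b ^+ 2; set Y := a * b / N.
have P0 : 0 <= P by rewrite divr_ge0 ?sqr_ge0 // ltW.
have Q0 : 0 <= Q by rewrite mulr_ge0 ?sqr_ge0 // ltW.
(* Arithmetic-geometric mean, from Y^2 (N x) = P Q and the size of N x. *)
have Y8 : (2 * x + 1) * `|Y| <= (P + Q) / 8.
  rewrite -(@ler_pXn2r _ 2) // ?nnegrE; last 2 first.
  - by rewrite mulr_ge0 //; lra.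
  - lra.
  rewrite exprMn real_normK ?num_real //.
  have YPQ : Y ^+ 2 * (N * x) = P * Q.
    by rewrite /Y /P /Q; field; rewrite gt_eqF.
  have := ler_wpM2l (sqr_ge0 Y) big; rewrite YPQ.
  have := sqr_ge0 (P - Q); nra.
have Nx : (x / N) * 64 <= 1.
  rewrite -mulrA mulrC -mulrA ler_pdivrMl // mulr1 mulrC.
  by rewrite -(ler_pM2r x0); nra.
have -> : (x - 2^-1) * (a * b) / N = (x - 2^-1) * Y by rewrite -mulrA.
have sq : (a + x * b) ^+ 2 / (2 * (N + 1)) <= P / 2 + x * Y + (x / N) * Q / 2.
  have -> : P / 2 + x * Y + (x / N) * Q / 2 = (a + x * b) ^+ 2 / (2 * N).
    by rewrite /P /Q /Y; field; rewrite gt_eqF.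
  rewrite ler_wpM2l ?sqr_ge0 // lef_pV2 ?posrE; lra.
have Y1 : `|(x - 2^-1) * Y| <= (P + Q) / 8.
  apply: le_trans Y8; rewrite normrM ler_wpM2r // ler_norml; apply/andP; split; lra.
have Y2 : `|Y| <= (P + Q) / 8.
  by apply: le_trans Y8; rewrite ler_peMl //; lra.
have xQ : (x / N) * Q * 64 <= Q.
  by rewrite mulrAC; rewrite -[leRHS]mul1r ler_wpM2r.
move: Y1 Y2; rewrite !ler_norml => /andP[Y11 Y12] /andP[Y21 Y22].
by split; lra.
Qed.

(** The energy of the oscillator tends to 0, and x L_n(x)^2 is at most twice it. *)
Lemma laguerre0_cvg0 x : 0 < x -> L n x @[n --> \oo] --> 0.
Proof.
move=> x0.
pose a n := x * \sum_(k < n) L k x.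
pose F n := energy n%:R (a n) (L n x) x.
have [n0 n0P] : exists n0, forall n, (n0 <= n)%N ->
    0 < n%:R :> R /\ 16 * (2 * x + 1) ^+ 2 <= n%:R * x.
  exists (Num.truncn (16 * (2 * x + 1) ^+ 2 / x)).+1 => n nn.
  split; first by rewrite ltr0n (leq_trans _ nn).
  rewrite -ler_pdivrMr //; apply: le_trans (ltW (truncnS_gt _)) _.
  by rewrite ler_nat.
have FS n : F n.+1 =
    energy (n%:R + 1) (a n + x * L n x) (L n x - (a n + x * L n x) / (n%:R + 1)) x.
  have aS : a n.+1 = a n + x * L n x by rewrite /a big_ord_recr /= mulrDr.
  have n10 : n.+1%:R != 0 :> R by rewrite pnatr_eq0.
  rewrite /F -aS natr1; congr energy.
  have := laguerre0_rec n x; rewrite -/(a n.+1) => E.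
  by apply: (mulfI n10); rewrite mulrBr [X in _ - X]mulrC divfK //;
    move: E; rewrite mulrBr; lra.
have F0 : F n @[n --> \oo] --> 0.
  apply: (@cvg0_of_harmonic_decrease _ 8^-1 n0) => // [n|n] /n0P [n0' nx].
    by have [] := energy_bounds n%:R (a n) (L n x) x x0 n0' nx.
  by rewrite FS -[n.+1%:R]natr1; have [] := energy_bounds n%:R (a n) (L n x) x x0 n0' nx.
have F1 : 2 / x * F n @[n --> \oo] --> 0.
  by rewrite -(mulr0 (2 / x)); apply: cvgMr.
have sq : L n x ^+ 2 @[n --> \oo] --> 0.
  apply: (squeeze_cvgr _ (cvg_cst 0) F1); near=> n; rewrite sqr_ge0 /=.
  have /n0P [n0' nx] : (n0 <= n)%N by near: n; exact: nbhs_infty_ge.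
  have [_ + _] := energy_bounds n%:R (a n) (L n x) x x0 n0' nx.
  by rewrite mulrAC ler_pdivlMr // mulrC.
apply/cvgrPdist_lt => e e0.
have e20 : 0 < e ^+ 2 by rewrite exprn_gt0.
move/cvgrPdist_lt: sq => /(_ _ e20); apply: filterS => n.
rewrite !sub0r !normrN normrX => h.
by rewrite -(@ltr_pXn2r _ 2) // ?nnegrE // ltW.
Unshelve. all: by end_near. Qed.

End Decay.

(** * Bound and limit for the normalized polynomials of order a >= 0 *)

Section Averaging.
Context {R : realType}.
Implicit Types (x a : R) (n : nat).

Local Notation L k x := ((laguerre 0 k).[x]).

(** A Toeplitz argument: since h(n)/G(n) tends to 0 for G the partial sums of h,
    the average gives vanishing weight to each fixed index. *)
Lemma weighted_mean_cvg0 (h u : nat -> R) :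
    (forall i, 0 <= h i) -> 0 < h 0%N ->
    h n / (\sum_(i < n.+1) h i) @[n --> \oo] --> 0 ->
    u n @[n --> \oo] --> 0 ->
  (\sum_(k < n.+1) h (n - k)%N * u k) / (\sum_(i < n.+1) h i) @[n --> \oo] --> 0.
Proof.
move=> h0 h00 hG u0; set G := fun n => \sum_(i < n.+1) h i.
have G0 n : 0 < G n.
  by rewrite /G big_ord_recl ltr_pwDl // sumr_ge0.
have Gmono n k : G (n - k)%N <= G n.
  have : (n - k <= n)%N by rewrite leq_subr.
  move: (n - k)%N => m mn; rewrite /G (big_ord_widen n.+1 h) //.
  by rewrite [leRHS](bigID (fun i : 'I_n.+1 => (i < m.+1)%N)) /= lerDl sumr_ge0.
apply/cvgrPdist_lt => e e0.
have e20 : 0 < e / 2 by rewrite divr_gt0.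
have [K _ uK] : \forall n \near \oo, `|u n| < e / 2.
  by move/cvgrPdist_lt: u0 => /(_ _ e20); apply: filterS => n; rewrite sub0r normrN.
(* The weight of index k is at most h(n - k)/G(n - k), as G increases. *)
have headK : \sum_(k < K) `|u k| * (h (n - k)%N / G (n - k)%N) @[n --> \oo] --> 0.
  elim: (K) => [|k IHk].
    by under eq_fun do rewrite big_ord0; exact: cvg_cst.
  under eq_fun do rewrite big_ord_recr /=.
  have : `|u k| * (h (n - k)%N / G (n - k)%N) @[n --> \oo] --> `|u k| * 0.
    by apply: cvgMr; rewrite -(cvg_shiftn k); under eq_fun do rewrite addnK.
  by rewrite mulr0 => /(cvgD IHk); rewrite addr0.
move/cvgrPdist_lt: headK => /(_ _ e20) headK.
near=> n.
have Kn : (K <= n.+1)%N by near: n; exists K => // m /= Km; exact: leqW.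
have headn : `|0 - \sum_(k < K) `|u k| * (h (n - k)%N / G (n - k)%N)| < e / 2.
  by near: n.
rewrite sub0r normrN normrM normfV (gtr0_norm (G0 n)) -/(G n).
rewrite ltr_pdivrMr //.
apply: le_lt_trans (ler_norm_sum _ _ _) _.
have -> : \sum_(i < n.+1) `|h (n - i)%N * u i| =
    \sum_(i < K) `|u i| * h (n - i)%N + \sum_(K <= i < n.+1) `|u i| * h (n - i)%N.
  rewrite -(big_mkord predT (fun i => `|h (n - i)%N * u i|)).
  rewrite (@big_cat_nat _ _ _ K) //= big_mkord.
  by congr (_ + _); apply: eq_bigr => i _; rewrite normrM mulrC (ger0_norm (h0 _)).
have -> : e * G n = e / 2 * G n + e / 2 * G n by rewrite -mulrDl -splitr.
apply: ltr_leD.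
  rewrite sub0r normrN in headn; rewrite -ltr_pdivrMr //.
  apply: le_lt_trans headn; apply: le_trans (ler_norm _).
  rewrite mulr_suml; apply: ler_sum => k _.
  by rewrite -mulrA ler_wpM2l // ler_wpM2l // lef_pV2 ?posrE.
apply: le_trans (_ : \sum_(K <= i < n.+1) e / 2 * h (n - i)%N <= _).
  by apply: ler_sum_nat => i /andP[Ki _]; rewrite ler_wpM2r // ltW // uK.
rewrite -mulr_sumr ler_wpM2l ?(ltW e20) //.
rewrite /G (reindex_inj rev_ord_inj) /=.
rewrite -(big_mkord predT (fun i => h (n.+1 - i.+1)%N)).
rewrite [leRHS](@big_cat_nat _ _ _ K) //= lerDr.
by apply: sumr_ge0.
Unshelve. all: by end_near. Qed.

Lemma negbinom_ratio_cvg0 a : 0 <= a ->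
  negbinom a n / (\sum_(i < n.+1) negbinom a i) @[n --> \oo] --> 0.
Proof.
move=> a0; rewrite -cvg_shiftS.
have E : a * @harmonic R n @[n --> \oo] --> 0.
  by rewrite -(mulr0 a); apply: cvgMr; exact: cvg_harmonic.
apply: (squeeze_cvgr _ (cvg_cst 0) E); near=> n.
have h0 i : 0 <= negbinom a i by exact: negbinom_ge0.
rewrite divr_ge0 ?sumr_ge0 //=.
have G0 : 0 < \sum_(i < n.+2) negbinom a i.
  by rewrite big_ord_recl ltr_pwDl ?sumr_ge0 // /negbinom gbinom0.
rewrite ler_pdivrMr // mulrAC ler_pdivlMr ?ltr0Sn //.
rewrite -laguerre_at0_sum laguerre_at0 -negbinom_mul mulrC ler_wpM2r //.
by rewrite lerDr.
Unshelve. all: by end_near. Qed.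

Lemma nlaguerre_cvg0 a x : 0 <= a -> 0 < x ->
  nlaguerre a n x @[n --> \oo] --> 0.
Proof.
move=> a0 x0; rewrite /nlaguerre.
under eq_fun do rewrite laguerre_at0_sum laguerre_sum.
apply: (@weighted_mean_cvg0 (negbinom a) (fun k => L k x)).
- by move=> i; exact: negbinom_ge0.
- by rewrite /negbinom gbinom0.
- exact: negbinom_ratio_cvg0.
- exact: laguerre0_cvg0.
Qed.

Lemma nlaguerre_bound a n x : 0 <= a -> 0 <= x ->
  `|nlaguerre a n x| <= expR (x / 2).
Proof.
move=> a0 x0; rewrite /nlaguerre laguerre_at0_sum laguerre_sum.
have h0 i : 0 <= negbinom a i by exact: negbinom_ge0.
have G0 : 0 < \sum_(i < n.+1) negbinom a i.
  by rewrite big_ord_recl ltr_pwDl ?sumr_ge0 // /negbinom gbinom0.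
rewrite normrM normfV (gtr0_norm G0) ler_pdivrMr //.
apply: le_trans (ler_norm_sum _ _ _) _.
rewrite mulr_sumr [leRHS](reindex_inj rev_ord_inj) /=; apply: ler_sum => k _.
by rewrite subSS normrM (ger0_norm (h0 _)) mulrC ler_wpM2r // laguerre0_bound.
Qed.

End Averaging.

(** * Passage to the integrals *)

Lemma complex_cvg0 (R : realType) (u : nat -> R[i]) :
  complex.Re (u k) @[k --> \oo] --> (0 : R) ->
  complex.Im (u k) @[k --> \oo] --> (0 : R) ->
  u k @[k --> \oo] --> (0 : R[i]^o).
Proof.
move=> re im; apply/(@cvgrPdist_lt R[i] R[i]^o) => e; rewrite ltcE => /andP[/eqP e0 e1].
have s : complex.Re (u k) * complex.Re (u k) + complex.Im (u k) * complex.Im (u k)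
    @[k --> \oo] --> (0 : R).
  by have := cvgD (cvgM re re) (cvgM im im); rewrite mulr0 addr0; apply.
have : Num.sqrt (complex.Re (u k) * complex.Re (u k) +
    complex.Im (u k) * complex.Im (u k)) @[k --> \oo] --> Num.sqrt (0 : R).
  by apply: continuous_cvg s; exact: sqrt_continuous.
rewrite sqrtr0 => /cvgrPdist_lt /(_ _ e1); apply: filterS => k.
rewrite !sub0r !normrN normc_def ltcE /= e0 eqxx /=.
by rewrite ger0_norm ?sqrtr_ge0 // !expr2.
Qed.

Lemma normcE (R : rcfType) (z : R[i]) :
  Normc.normc z = Num.sqrt (complex.Re z ^+ 2 + complex.Im z ^+ 2).
Proof. by case: z. Qed.

Lemma measurable_normc d (T : measurableType d) (R : realType) (D : set T)
    (f : T -> R[i]) :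
  complex_measurable_fun D f -> measurable_fun D (fun x => Normc.normc (f x)).
Proof.
move=> [mre mim]; under eq_fun do rewrite normcE.
apply: measurableT_comp.
  by apply: continuous_measurable_fun; exact: sqrt_continuous.
by apply: measurable_funD; apply: measurable_funX.
Qed.

Section Coefficients.
Context {R : realType}.

Local Notation mu := (@completed_lebesgue_measure R).
Local Notation T := (caratheodory_type (wlength (@idfun R))^*%mu).
Local Notation D := (`]0, +oo[%classic : set R).

(** Borel sets are Lebesgue measurable. *)
Lemma measurable_id_lebesgue :
  @measurable_fun _ _ T R setT idfun.
Proof.
by move=> _ Y mY; rewrite setTI; exact: sub_caratheodory.
Qed.

Lemma measurable_borel_lebesgue (g : R -> R) (E : set T) :
  measurable_fun [set: R] g -> @measurable_fun _ _ T R E g.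
Proof.
move=> mg; apply: (@measurable_funS _ _ T R setT) => //.
exact: (measurableT_comp mg measurable_id_lebesgue).
Qed.

Lemma measurable_halfline : measurable (D : set T).
Proof.
have := measurable_id_lebesgue measurableT _ (measurable_itv `]0, +oo[).
by rewrite setTI.
Qed.

Definition laguerre_weight (alpha : R) (k : nat) (x : R) : R :=
  nlaguerre alpha k x * x `^ alpha * expR (- x).

Lemma measurable_laguerre_weight (alpha : R) k (E : set T) :
  @measurable_fun _ _ T R E (laguerre_weight alpha k).
Proof.
apply: measurable_borel_lebesgue; apply: measurable_funM.
  apply: measurable_funM; last exact: measurable_powR.
  apply: continuous_measurable_fun => x; apply: cvgMl.
  exact: continuous_horner.
by apply: measurableT_comp => //; exact: measurable_funN.
Qed.

(** Dominated convergence: the bound exp(x/2) on the normalized polynomials turns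
    the weight x^alpha exp(-x) into the weight of the norm of the space. *)
Lemma weighted_integral_cvg0 (alpha : R) (phi psi : R -> R) :
    0 <= alpha ->
    @measurable_fun _ _ T R D phi -> @measurable_fun _ _ T R D psi ->
    (forall x, `|phi x| <= psi x) ->
    (\int[mu]_(x in D) (psi x * expR (- (x / 2)) * x `^ alpha)%:E < +oo)%E ->
  (forall k, mu.-integrable D (EFin \o (fun x => phi x * laguerre_weight alpha k x))) /\
  \int[mu]_(x in D) (phi x * laguerre_weight alpha k x) @[k --> \oo] --> 0.
Proof.
move=> alpha0 mphi mpsi phipsi fin; have mD := measurable_halfline.
pose g x := psi x * expR (- (x / 2)) * x `^ alpha.
have psi0 x : 0 <= psi x by apply: le_trans (phipsi x).
have g0 x : 0 <= g x by rewrite !mulr_ge0 ?expR_ge0 ?powR_ge0.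
have mg : @measurable_fun _ _ T R D g.
  apply: measurable_funM; last by apply: measurable_borel_lebesgue; exact: measurable_powR.
  apply: measurable_funM => //; apply: measurable_borel_lebesgue.
  by apply: measurableT_comp => //; apply: measurable_funN; exact: measurable_funM.
have ig : mu.-integrable D (EFin \o g).
  apply/integrableP; split; first exact/measurable_EFinP.
  by under eq_integral => x _ do rewrite /= (ger0_norm (g0 x)).
have mf k : @measurable_fun _ _ T R D (fun x => phi x * laguerre_weight alpha k x).
  by apply: measurable_funM => //; exact: measurable_laguerre_weight.
have dom k x : D x -> `|phi x * laguerre_weight alpha k x| <= g x.
  rewrite /= in_itv /= andbT => x0.
  rewrite normrM /g -mulrA; apply: ler_pM => //.
  rewrite /laguerre_weight normrM (normrM (nlaguerre _ _ _)).
  rewrite (ger0_norm (powR_ge0 _ _)) (ger0_norm (expR_ge0 _)).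
  rewrite mulrAC ler_wpM2r ?powR_ge0 //.
  apply: le_trans (_ : expR (x / 2) * expR (- x) <= _).
    by rewrite ler_wpM2r ?expR_ge0 // nlaguerre_bound // ltW.
  by rewrite -expRD ler_expR; lra.
split=> [k|].
  apply: (le_integrable mD) ig; first exact/measurable_EFinP.
  by move=> x Dx; rewrite /= lee_fin (ger0_norm (g0 x)) dom.
apply: (fine_cvg (a := 0)).
rewrite -[0%:E](integral0 mu D).
apply: (dominated_cvg mD _ _ _ ig).
- by move=> k; apply/measurable_EFinP.
- move=> x; rewrite /= in_itv /= andbT => x0; apply: cvg_EFin.
    exact: nearW.
  have lim : phi x * (nlaguerre alpha k x * (x `^ alpha * expR (- x)))
      @[k --> \oo] --> phi x * (0 * (x `^ alpha * expR (- x))).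
    by apply: cvgMr; apply: cvgMl; exact: nlaguerre_cvg0.
  rewrite mul0r mulr0 in lim; apply: cvg_trans lim.
  apply: near_eq_cvg; apply: nearW => k.
  by rewrite /laguerre_weight /= (mulrA (nlaguerre alpha k x)).
- by [].
- by move=> k x Dx; rewrite /= lee_fin dom.
Qed.

End Coefficients.

Theorem mainTheorem2 (R : realType) (alpha : R) (halpha : 0 <= alpha)
    (f : R -> R[i]) (hf : in_Lw alpha f) :
  (forall k : nat, laguerre_coef_exists alpha f k) /\
  (laguerre_coef alpha f k @[k --> \oo] --> (0 : R[i]^o)).
Proof.
have [mf fin] := hf; have [mre mim] := mf.
have reE k x : complex.Re (laguerre_integrand alpha f k x) =
    complex.Re (f x) * laguerre_weight alpha k x.
  by rewrite /laguerre_integrand; case: (f x) => a b /=; rewrite mulr0 subr0.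
have imE k x : complex.Im (laguerre_integrand alpha f k x) =
    complex.Im (f x) * laguerre_weight alpha k x.
  by rewrite /laguerre_integrand; case: (f x) => a b /=; rewrite mulr0 add0r.
pose n x := Normc.normc (f x).
have mn := measurable_normc _ _ _ _ _ mf.
have ren x : `|complex.Re (f x)| <= n x.
  by rewrite /n normcE -sqrtr_sqr ler_sqrt ?addr_ge0 ?sqr_ge0 // lerDl sqr_ge0.
have imn x : `|complex.Im (f x)| <= n x.
  by rewrite /n normcE -sqrtr_sqr ler_sqrt ?addr_ge0 ?sqr_ge0 // lerDr sqr_ge0.
have [ire cre] := weighted_integral_cvg0 alpha _ _ halpha mre mn ren fin.
have [iim cim] := weighted_integral_cvg0 alpha _ _ halpha mim mn imn fin.
split=> [k|].
  rewrite /laguerre_coef_exists /complex_integrable.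
  by rewrite (funext (reE k)) (funext (imE k)); split; [exact: ire|exact: iim].
apply: complex_cvg0; rewrite /laguerre_coef /complex_integral /=.
  by under eq_fun do rewrite (funext (reE _)).
by under eq_fun do rewrite (funext (imE _)).
Qed.
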